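(* There exist a constant $c>0$ and, for infinitely many positive integers $n$, an $n$-vertex biconnected outerplanar graph $G_n$ such that every convex grid drawing of $G_n$ has area at least $c\,n^{3}$. (That is, there exists an $n$-vertex biconnected outerplanar graph that requires $\Omega(n^3)$ area in every convex grid drawing.)
   Context: A graph is outerplanar if it admits a planar drawing in which every vertex is incident to the outer (unbounded) face. A grid drawing of a graph maps vertices to distinct points with integer coordinates. A straight-line drawing draws each edge as the segment between its endpoints; it is planar if no two edges intersect except at a common endpoint. A convex drawing is a planar straight-line drawing in which the boundary of every face, including the outer face, is a convex polygon, i.e. a polygon all of whose internal angles are at most $180^\circ$ (the drawing is not required to be outerplanar or to respect any prescribed embedding). For a grid drawing $\Gamma$, its width is $\max_x(\Gamma)-\min_x(\Gamma)+1$ and its height is $\max_y(\Gamma)-\min_y(\Gamma)+1$, where $\max_q,\min_q$ denote the maximum and minimum $q$-coordinate of a vertex; the area is width times height. *)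

(* Defs.v *)
From HB Require Import structures.
From mathcomp Require Import all_boot all_order all_algebra.
From mathcomp Require Import all_classical all_reals topology normedtype.
Set Implicit Arguments. Unset Strict Implicit. Unset Printing Implicit Defensive.
Import Order.TTheory GRing.Theory Num.Theory numFieldNormedType.Exports.
Local Open Scope classical_set_scope.
Local Open Scope ring_scope.

Definition simple_graph (n : nat) (e : rel 'I_n) : Prop :=
  symmetric e /\ irreflexive e.

Definition avoid_rel (n : nat) (e : rel 'I_n) (v : 'I_n) : rel 'I_n :=
  [rel a b | [&& e a b, a != v & b != v]].

Definition graph_connected (n : nat) (e : rel 'I_n) : Prop :=
  forall x y : 'I_n, connect e x y.

Definition biconnected (n : nat) (e : rel 'I_n) : Prop :=
  [/\ (3 <= n)%N, graph_connected e &
      forall v x y : 'I_n, x != v -> y != v -> connect (avoid_rel e v) x y].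

Notation pt R := (R * R)%type (only parsing).

Definition segment (R : realType) (a b : pt R) : set (pt R) :=
  [set q | exists t : R, [/\ 0 <= t, t <= 1 &
     q = ((1 - t) * a.1 + t * b.1, (1 - t) * a.2 + t * b.2)]].

Definition convex_set2 (R : realType) (S : set (pt R)) : Prop :=
  forall a b, S a -> S b -> segment a b `<=` S.

Definition bounded2 (R : realType) (S : set (pt R)) : Prop :=
  exists M : R, forall q, S q -> `|q.1| <= M /\ `|q.2| <= M.

Definition drawing_set (R : realType) (n : nat) (e : rel 'I_n)
  (p : 'I_n -> pt R) : set (pt R) :=
  [set q | (exists v, q = p v) \/ (exists u v, e u v /\ segment (p u) (p v) q)].

Definition planar_straight_line (R : realType) (n : nat) (e : rel 'I_n)
  (p : 'I_n -> pt R) : Prop :=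
  injective p /\
  (forall u v z, e u v -> z != u -> z != v -> ~ segment (p u) (p v) (p z)) /\
  forall u v w x, e u v -> e w x ->
    ~~ ((u == w) && (v == x) || (u == x) && (v == w)) ->
    forall q, segment (p u) (p v) q -> segment (p w) (p x) q ->
      exists z, [/\ (z == u) || (z == v), (z == w) || (z == x) & q = p z].

Definition face (R : realType) (n : nat) (e : rel 'I_n)
  (p : 'I_n -> pt R) (F : set (pt R)) : Prop :=
  exists x, ~ drawing_set e p x /\ F = connected_component (~` drawing_set e p) x.

Definition outer_face (R : realType) (n : nat) (e : rel 'I_n)
  (p : 'I_n -> pt R) (F : set (pt R)) : Prop :=
  face e p F /\ ~ bounded2 F.

(* convex drawing: planar straight-line drawing in which every face boundary
   is a convex polygon, i.e. every bounded (inner) face is a convex region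
   and the closed region bounded by the outer face boundary (the complement
   of the outer face) is convex *)
Definition convex_drawing (R : realType) (n : nat) (e : rel 'I_n)
  (p : 'I_n -> pt R) : Prop :=
  planar_straight_line e p /\
  forall F, face e p F ->
    (bounded2 F -> convex_set2 F) /\ (~ bounded2 F -> convex_set2 (~` F)).

Definition outerplanar (R : realType) (n : nat) (e : rel 'I_n) : Prop :=
  exists p : 'I_n -> pt R, planar_straight_line e p /\
    forall v, exists F, outer_face e p F /\ closure F (p v).

Definition grid_to_pt (R : realType) (n : nat) (g : 'I_n -> int * int) :
  'I_n -> pt R := fun v => (((g v).1)%:~R, ((g v).2)%:~R).

Definition grid_width (n : nat) (g : 'I_n -> int * int) : nat :=
  (\max_(i : 'I_n) \max_(j : 'I_n) `|(g i).1 - (g j).1|%N).+1.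
Definition grid_height (n : nat) (g : 'I_n -> int * int) : nat :=
  (\max_(i : 'I_n) \max_(j : 'I_n) `|(g i).2 - (g j).2|%N).+1.
Definition grid_area (n : nat) (g : 'I_n -> int * int) : nat :=
  grid_width g * grid_height g.

Definition convex_grid_drawing (R : realType) (n : nat) (e : rel 'I_n)
  (g : 'I_n -> int * int) : Prop :=
  injective g /\ convex_drawing e (grid_to_pt R g).

(* Main.v *)
(* The graph is a polygon with a triangle (an ear) glued to each side.  If [v] is the
   apex of an ear with neighbours [u] and [w], consider the line through [v] parallel to
   [uw].  Near [v], this line without [v] and its side away from [u] and [w] lie in a
   single face, and [v] is the midpoint of two points of that face.  So the face is not
   convex, hence its complement is, and then the line strictly separates [v] from all other vertices.
   This holds whatever embedding or outer face the drawing uses.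
   The apices are thus lattice points in strictly convex position.  At least a quarter
   of them have supporting functionals of the same signs, and those form a monotone
   chain with distinct increments; [k] distinct increments with positive entries
   summing to [(X, Y)] force [k ^ 3 <= 32 * X * Y]. *)
Require Import Defs.
From HB Require Import structures.
From mathcomp Require Import all_boot all_order all_algebra.
From mathcomp Require Import all_classical all_reals topology normedtype.
From mathcomp Require Import zify ring lra.
Import Order.TTheory GRing.Theory Num.Theory numFieldNormedType.Exports.
Local Open Scope ring_scope.

(** * Topology of segments in the plane *)

Lemma pair_ext (T1 T2 : Type) (q : T1 * T2) (x : T1) (y : T2) :
  q.1 = x -> q.2 = y -> q = (x, y).
Proof. by case: q => ? ? /= -> ->. Qed.

Lemma segment_left (R : realType) (a b : R * R) : segment a b a.
Proof.
exists 0; split=> //.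
by rewrite subr0 !mul1r !mul0r !addr0; case: a.
Qed.

Lemma segment_right (R : realType) (a b : R * R) : segment a b b.
Proof.
exists 1; split=> //.
by rewrite subrr !mul1r !mul0r !add0r; case: b.
Qed.

Lemma segment_sym (R : realType) (a b : R * R) :
  (segment a b `<=` segment b a)%classic.
Proof.
move=> q [t [t0 t1 ->]]; exists (1 - t); split; [lra|lra|].
by congr (_, _); ring.
Qed.

Lemma segment_image (R : realType) (a b : R * R) :
  segment a b = ((fun t : R => ((1 - t) * a.1 + t * b.1, (1 - t) * a.2 + t * b.2))
    @` `[0, 1])%classic.
Proof.
apply/seteqP; split=> q /=.
  move=> [t [t0 t1 ->]]; exists t => //.
  by rewrite in_itv /= t0 t1.
move=> [t]; rewrite in_itv /= => /andP[t0 t1] <-.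
by exists t.
Qed.

Lemma continuous_segment (R : realType) (a b : R * R) : continuous
  (fun t : R => ((1 - t) * a.1 + t * b.1, (1 - t) * a.2 + t * b.2)).
Proof.
move=> t.
have line (c d : R) : ((1 - s) * c + s * d @[s --> t] --> (1 - t) * c + t * d)%classic.
  apply: cvgD; apply: cvgM; try exact: cvg_cst; last exact: cvg_id.
  by apply: cvgB; [exact: cvg_cst|exact: cvg_id].
exact: (cvg_pair (line _ _) (line _ _)).
Qed.

Lemma connected_segment (R : realType) (a b : R * R) : connected (segment a b).
Proof.
rewrite segment_image; apply: connected_continuous_connected.
  exact: segment_connected.
exact/continuous_subspaceT/continuous_segment.
Qed.

Lemma closed_segment (R : realType) (a b : R * R) : closed (segment a b).
Proof.
apply: compact_closed; first exact: norm_hausdorff.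
rewrite segment_image; apply: continuous_compact.
  exact/continuous_subspaceT/continuous_segment.
exact: segment_compact.
Qed.

Lemma connected_component_segment (R : realType) (S : set (R * R)) (a b : R * R) :
  (segment a b `<=` S)%classic -> connected_component S a b.
Proof.
move=> sub; apply: (@connected_component_max _ S (segment a b) a) => //.
- exact: segment_left.
- exact: connected_segment.
- exact: segment_right.
Qed.

(** * Local geometry at the apex of an ear *)

(** Segments are closed, so each complement is a neighbourhood of [v]; finitely many of these
    intersect in a neighbourhood, and balls of the product are boxes. *)
Lemma box_avoiding_segments (R : realType) (I : finType) (P : pred I)
    (a b : I -> R * R) (v : R * R) :
  (forall i, P i -> ~ segment (a i) (b i) v) ->
  exists2 eps : R, 0 < eps & forall q : R * R,
    `|q.1 - v.1| < eps -> `|q.2 - v.2| < eps ->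
    forall i, P i -> ~ segment (a i) (b i) q.
Proof.
move=> avoid.
have : \forall q \near v, forall i : I, P i -> ~ segment (a i) (b i) q.
  have FF : Filter (nbhs v) by exact: nbhs_filter.
  apply (@filter_forall _ I (fun i q => P i -> ~ segment (a i) (b i) q) _ FF) => i.
  case: (boolP (P i)) => Pi; last by apply: nearW => q.
  have op := closed_openC (closed_segment _ (a i) (b i)).
  by apply: filterS (open_nbhs_nbhs (conj op (avoid i Pi))) => q ? _.
move=> /nbhs_ballP[eps /= eps0 sub]; exists eps => // q q1 q2.
apply: sub; split => /=; by rewrite /ball /= distrC.
Qed.

Lemma small_scaling (R : realType) (w : R * R) (eps : R) : 0 < eps ->
  exists t : R, [/\ 0 < t, t <= 1, `|t * w.1| < eps & `|t * w.2| < eps].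
Proof.
move=> eps0.
have M0 : 0 < `|w.1| + `|w.2| + eps by have := normr_ge0 w.1; have := normr_ge0 w.2; lra.
(* The summand [eps] keeps the denominator positive when [w] is zero and the quotient at most 1. *)
exists (eps / (`|w.1| + `|w.2| + eps)).
have := normr_ge0 w.1; have := normr_ge0 w.2 => h1 h2.
split.
- by rewrite divr_gt0.
- by rewrite ler_pdivrMr //; lra.
- rewrite normrM gtr0_norm ?divr_gt0// mulrAC ltr_pdivrMr//.
  by nra.
- rewrite normrM gtr0_norm ?divr_gt0// mulrAC ltr_pdivrMr//.
  by nra.
Qed.

(* If no point of the triple lies between the two others, they are not collinear. *)
Lemma cross_neq0 (R : realType) (v a b : R * R) :
  a <> v -> b <> v -> ~ segment a b v -> ~ segment v a b -> ~ segment v b a ->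
  (a.1 - v.1) * (b.2 - v.2) - (a.2 - v.2) * (b.1 - v.1) != 0.
Proof.
move=> av bv nv nb na; apply/negP => /eqP det0.
have sqnorm_gt0 (c : R * R) : c <> v -> 0 < (c.1 - v.1) ^+ 2 + (c.2 - v.2) ^+ 2.
  move=> cv; rewrite lt_def addr_ge0 ?sqr_ge0// andbT.
  rewrite paddr_eq0 ?sqr_ge0// !sqrf_eq0 !subr_eq0; apply/negP => /andP[/eqP h1 /eqP h2].
  by apply: cv; rewrite (surjective_pairing c) h1 h2 -surjective_pairing.
have A0 := sqnorm_gt0 _ av.
set A1 := a.1 - v.1 in det0 A0; set A2 := a.2 - v.2 in det0 A0.
set B1 := b.1 - v.1 in det0; set B2 := b.2 - v.2 in det0.
(* [l] is the coefficient of the orthogonal projection of [b - v] on [a - v]. With zero determinant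
   [b = v + l (a - v)], and the position of [l] relative to 0 and 1 tells which point lies between
   the two others. *)
pose l := (A1 * B1 + A2 * B2) / (A1 ^+ 2 + A2 ^+ 2).
have A0' : A1 ^+ 2 + A2 ^+ 2 != 0 by rewrite gt_eqF.
have e1 : b.1 = v.1 + l * A1.
  suff : B1 = l * A1 by rewrite /B1 => <-; ring.
  apply: (mulIf A0'); rewrite /l mulrAC divfK//.
  apply/eqP; rewrite -subr_eq0; apply/eqP.
  have -> : B1 * (A1 ^+ 2 + A2 ^+ 2) - (A1 * B1 + A2 * B2) * A1 =
    - A2 * (A1 * B2 - A2 * B1) by ring.
  by rewrite det0 mulr0.
have e2 : b.2 = v.2 + l * A2.
  suff : B2 = l * A2 by rewrite /B2 => <-; ring.
  apply: (mulIf A0'); rewrite /l mulrAC divfK//.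
  apply/eqP; rewrite -subr_eq0; apply/eqP.
  have -> : B2 * (A1 ^+ 2 + A2 ^+ 2) - (A1 * B1 + A2 * B2) * A2 =
    A1 * (A1 * B2 - A2 * B1) by ring.
  by rewrite det0 mulr0.
case: (leP l 0) => l0.
  apply: nv; exists ((1 - l)^-1).
  have l1 : 0 < 1 - l by lra.
  split; first by rewrite invr_ge0 ltW.
    by rewrite invf_le1//; lra.
  by apply: pair_ext; rewrite ?e1 ?e2 /A1 /A2; field; rewrite gt_eqF // (lt_trans _ l1).
case: (leP l 1) => l1.
  apply: nb; exists l; split=> //; first lra.
  by apply: pair_ext; rewrite ?e1 ?e2 /A1 /A2; ring.
apply: na; exists l^-1.
split; first by rewrite invr_ge0 ltW.
  by rewrite invf_le1//; lra.
by apply: pair_ext; rewrite ?e1 ?e2 /A1 /A2; field; rewrite gt_eqF // (lt_trans _ l1).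
Qed.

(* [a * x + b * y] is the functional that is constant on the direction of the edge
   joining the two neighbours of [v]. *)
Lemma ear_extreme (R : realType) (n : nat) (e : rel 'I_n) (p : 'I_n -> R * R)
    (v u w : 'I_n) :
  convex_drawing e p -> symmetric e -> irreflexive e ->
  e v u -> e v w -> e u w -> (forall z, e v z -> z = u \/ z = w) ->
  exists a b : R, forall z, z != v ->
    0 < a * ((p z).1 - (p v).1) + b * ((p z).2 - (p v).2).
Proof.
move=> [[pinj [novtx _]] faces] esym eirr evu evw euw evn.
have neq x y : e x y -> x != y by move=> h; apply/eqP => E; rewrite E eirr in h.
have vu := neq _ _ evu; have vw := neq _ _ evw; have uw := neq _ _ euw.
have det := @cross_neq0 R (p v) (p u) (p w).
have {det}/det : p u <> p v by move=> /pinj E; rewrite E eqxx in vu.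
have pwv : p w <> p v by move=> /pinj E; rewrite E eqxx in vw.
move=> /(_ pwv (novtx _ _ _ euw vu vw)) det.
have {det}/det det : ~ segment (p v) (p u) (p w) by apply: novtx evu _ _; rewrite eq_sym.
have {det}/det det : ~ segment (p v) (p w) (p u) by apply: novtx evw _ _; rewrite // eq_sym.
set V := p v in det *.
set A1 := (p u).1 - V.1 in det *; set A2 := (p u).2 - V.2 in det *.
set B1 := (p w).1 - V.1 in det *; set B2 := (p w).2 - V.2 in det *.
set D := A1 * B2 - A2 * B1 in det *.
(* Dividing by [D] normalises [f] to the value 1 at both neighbours of [v], whatever the orientation
   of the triangle. *)
pose f (q : R * R) := (B2 - A2) / D * (q.1 - V.1) + (A1 - B1) / D * (q.2 - V.2).
exists ((B2 - A2) / D), ((A1 - B1) / D) => z zv.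
change (0 < f (p z)).
have fu : f (p u) = 1 by rewrite /f -/A1 -/A2; move: det; rewrite /D => det; field.
have fw : f (p w) = 1 by rewrite /f -/B1 -/B2; move: det; rewrite /D => det; field.
have fV : f V = 0 by rewrite /f !subrr !mulr0 addr0.
have fseg (x y q : R * R) (t : R) :
    q = ((1 - t) * x.1 + t * y.1, (1 - t) * x.2 + t * y.2) ->
    f q = (1 - t) * f x + t * f y.
  by move=> ->; rewrite /f /=; ring.
pose far (xy : 'I_n * 'I_n) := ((xy.1 == xy.2) || e xy.1 xy.2) && (xy.1 != v) && (xy.2 != v).
have [eps eps0 box] : exists2 eps : R, 0 < eps & forall q : R * R,
    `|q.1 - V.1| < eps -> `|q.2 - V.2| < eps ->
    forall xy, far xy -> ~ segment (p xy.1) (p xy.2) q.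
  apply: box_avoiding_segments => -[x y] /andP[/andP[/= /orP[/eqP<-|exy] xv] yv].
    move=> [t [_ _ E]]; have /pinj E' : p x = V.
      by rewrite E /=; apply: pair_ext; ring.
    by rewrite E' eqxx in xv.
  by apply: novtx exy _ _; rewrite eq_sym.
pose near (q : R * R) := `|q.1 - V.1| < eps /\ `|q.2 - V.2| < eps.
(* In the box only the two edges at [v] can be met, and [f] is positive on them except at [V]. *)
have free q : near q -> f q <= 0 -> q <> V -> ~ drawing_set e p q.
  move=> [q1 q2] fq qV [[x Ex]|[x [y [exy sxy]]]].
    case: (eqVneq x v) => [E|xv]; first by apply: qV; rewrite Ex E.
    apply: (box q q1 q2 (x, x)); first by rewrite /far /= eqxx xv.
    by rewrite /= Ex; exact: segment_left.
  have vedge y' : e v y' -> ~ segment (p v) (p y') q.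
    move=> evy [t [t0 t1 E]]; have := fseg _ _ _ _ E.
    rewrite -/V fV mulr0 add0r.
    have -> : f (p y') = 1 by case: (evn _ evy) => ->.
    rewrite mulr1 => ft; apply: qV; rewrite E.
    have -> : t = 0 by lra.
    by rewrite subr0 !mul0r !mul1r !addr0 -surjective_pairing.
  case: (eqVneq x v) => [E|xv]; first by subst x; case: (vedge _ exy sxy).
  case: (eqVneq y v) => [E|yv].
    by subst y; rewrite esym in exy; case: (vedge _ exy (segment_sym _ _ _ _ sxy)).
  by apply: (box q q1 q2 (x, y)) => //; rewrite /far /= exy xv yv orbT.
have [s [s0 s1 sn1 sn2]] := small_scaling R (A1 + B1, A2 + B2) eps eps0.
(* A point of the box on the side of [V] opposite to the two neighbours. *)
pose O : R * R := (V.1 - s * (A1 + B1), V.2 - s * (A2 + B2)).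
have nearO : near O.
  by rewrite /near /= ![_ - _ * _ - _]addrAC !subrr !sub0r !normrN.
have fO : f O < 0.
  have -> : f O = - s * (f (p u) + f (p w)).
    by rewrite /f /= -/A1 -/A2 -/B1 -/B2; ring.
  by rewrite fu fw; lra.
set F := connected_component (~` drawing_set e p)%classic O.
have Ofree : ~ drawing_set e p O.
  by apply: free => //; [exact: ltW|move=> E; rewrite E fV ltxx in fO].
have faceF : face e p F by exists O.
(* The segment from [q] to [O] stays in the box and in the half-plane where [f] is nonpositive. As
   [f O < 0], [f] is negative on it except possibly at [q], so it misses [V]. *)
have inF q : near q -> f q <= 0 -> q <> V -> F q.
  move=> [q1 q2] fq qV.
  apply: connected_component_sym.
  apply: connected_component_segment => r [t [t0 t1 E]].
  have fr := fseg _ _ _ _ E.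
  have rE (a b o : R) : (1 - t) * a + t * o - b = (1 - t) * (a - b) + t * (o - b) by ring.
  have nr (a b o : R) : `|a - b| < eps -> `|o - b| < eps ->
      `|(1 - t) * a + t * o - b| < eps.
    rewrite rE => ab ob; apply: le_lt_trans (ler_normD _ _) _.
    have t1' : 0 <= 1 - t by lra.
    rewrite !normrM (ger0_norm t0) (ger0_norm t1').
    have := ltW ob; rewrite -subr_ge0 => /(mulr_ge0 t0).
    move: (t1'); rewrite le_eqVlt => /orP[/eqP E1|t1'']; last first.
      move: ab; rewrite -subr_gt0 => /(mulr_gt0 t1''); lra.
    have -> : t = 1 by lra.
    lra.
  apply: free.
  - by rewrite E; split; apply: nr => //; case: nearO.
  - by rewrite fr; nra.
  - move=> rV; move: fr; rewrite rV fV => fr.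
    have t00 : t = 0 by nra.
    apply: qV; rewrite -rV E t00 !subr0 !mul0r !mul1r !addr0.
    by rewrite -surjective_pairing.
have VnF : ~ F V by move=> /connected_component_sub; apply; left; exists v.
(* If [F] were bounded it would be convex, yet [V] is the midpoint of [q1] and [q2], which lie in
   [F] on the line where [f] vanishes. *)
have [bd|ubd] := EM (bounded2 F).
  have [r [r0 r1 rn1 rn2]] := small_scaling R (A1 - B1, A2 - B2) eps eps0.
  have dir_neq0 : ~ (r * (A1 - B1) = 0 /\ r * (A2 - B2) = 0).
    move=> [/eqP + /eqP]; rewrite !mulf_eq0 !(gt_eqF r0) /= !subr_eq0 => /eqP h1 /eqP h2.
    by move/eqP: det; rewrite /D h1 h2; apply; ring.
  exfalso; apply: VnF.
  have cvx := (faces F faceF).1 bd.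
  pose q1 : R * R := (V.1 + r * (A1 - B1), V.2 + r * (A2 - B2)).
  pose q2 : R * R := (V.1 - r * (A1 - B1), V.2 - r * (A2 - B2)).
  apply: (cvx q1 q2).
  - apply: inF; first by rewrite /near /= ![_ + _ * _ - _]addrAC !subrr !add0r.
      have -> : f q1 = r * (f (p u) - f (p w)).
        by rewrite /f /= -/A1 -/A2 -/B1 -/B2; ring.
      by rewrite fu fw subrr mulr0.
    move=> E; apply: dir_neq0.
    by have := congr1 fst E; have := congr1 snd E; rewrite /=; split; lra.
  - apply: inF; first by rewrite /near /= ![_ - _ * _ - _]addrAC !subrr !sub0r !normrN.
      have -> : f q2 = r * (f (p w) - f (p u)).
        by rewrite /f /= -/A1 -/A2 -/B1 -/B2; ring.
      by rewrite fu fw subrr mulr0.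
    move=> E; apply: dir_neq0.
    by have := congr1 fst E; have := congr1 snd E; rewrite /=; split; lra.
  - exists (1 / 2); split; [lra|lra|].
    by apply: pair_ext => /=; field.
(* Now the complement of [F] is convex and contains [V] and [p z]. If [f (p z)] were nonpositive, a
   point of their segment close to [V] would lie in [F]. *)
rewrite ltNge; apply/negP => fz.
have cvx := (faces F faceF).2 ubd.
have znF : ~ F (p z) by move=> /connected_component_sub; apply; left; exists z.
have [r [r0 r1 rn1 rn2]] := small_scaling R ((p z).1 - V.1, (p z).2 - V.2) eps eps0.
have Eq : ((1 - r) * V.1 + r * (p z).1, (1 - r) * V.2 + r * (p z).2) =
          (V.1 + r * ((p z).1 - V.1), V.2 + r * ((p z).2 - V.2)).
  by congr (_, _); ring.
apply: (cvx V (p z) VnF znF ((1 - r) * V.1 + r * (p z).1, (1 - r) * V.2 + r * (p z).2)).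
  by exists r; split=> //; exact: ltW.
apply: inF.
- by rewrite Eq /near /= ![_ + _ * _ - _]addrAC !subrr !add0r.
- by rewrite (fseg V (p z) _ r erefl) fV; nra.
- rewrite Eq => E; move: zv.
  have : p z = V.
    rewrite [LHS]surjective_pairing [RHS]surjective_pairing.
    have := congr1 fst E; have := congr1 snd E; rewrite /= => h2 h1.
    have /eqP : r * ((p z).1 - V.1) = 0 by lra.
    have /eqP : r * ((p z).2 - V.2) = 0 by lra.
    by rewrite !mulf_eq0 !(gt_eqF r0) /= !subr_eq0 => /eqP -> /eqP ->.
  by move=> /pinj ->; rewrite eqxx.
Qed.

(** * Lattice points in strictly convex position *)

(** By Markov's inequality at most a quarter of the indices have [a i] above [4 X / k], and likewise
    for [b] and [Y]. So at least [k / 2] of the distinct pairs lie in a box with at most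
    [16 X Y / k ^ 2] positive integer points. *)
Lemma distinct_pairs_bound (k : nat) (a b : 'I_k -> nat) (X Y : nat) :
  (forall i, 0 < a i)%N -> (forall i, 0 < b i)%N ->
  (\sum_i a i <= X)%N -> (\sum_i b i <= Y)%N ->
  injective (fun i => (a i, b i)) -> (k ^ 3 <= 32 * (X * Y))%N.
Proof.
move=> a0 b0 aX bY inj.
have few (c : 'I_k -> nat) (Z : nat) : (forall i, 0 < c i)%N -> (\sum_i c i <= Z)%N ->
    (4 * #|[set i | (4 * Z < k * c i)%N]| <= k)%N.
  move=> c0 cZ; set B := [set i | _].
  have h : (#|B| * (4 * Z).+1 <= k * Z)%N.
    rewrite -sum_nat_const; apply: (@leq_trans (\sum_(i in B) k * c i)%N).
      by apply: leq_sum => i; rewrite inE.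
    rewrite -big_distrr /= leq_mul2l; apply/orP; right.
    by apply: leq_trans cZ; rewrite [leqRHS](bigID (mem B)) /= leq_addr.
  (* The factor [Z] can be cancelled only when positive; for [Z = 0] the bound [h] already gives
     [N = 0]. *)
  move: #|B| h => N; case: Z {B cZ} => [|Z] h; first by lia.
  by rewrite -(@leq_pmul2r Z.+1) //; lia.
case: (posnP k) => [k0|k0]; first by rewrite k0.
pose S := [set i | (k * a i <= 4 * X)%N && (k * b i <= 4 * Y)%N].
have cardS : (k <= 2 * #|S|)%N.
  have := few a X a0 aX; have := few b Y b0 bY.
  set A := [set i | _]; set B := [set i | _] => hA hB.
  have : (#|~: S| <= #|A| + #|B|)%N.
    apply: leq_trans (leq_card_setU A B).1; apply: subset_leq_card.
    by apply/fintype.subsetP => i; rewrite !inE negb_and -!ltnNge orbC.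
  have := cardsC S; rewrite card_ord; lia.
have Srs : (#|S| <= ((4 * X) %/ k) * ((4 * Y) %/ k))%N.
  set r := (_ %/ k)%N; set s := (_ %/ k)%N.
  have -> : (r * s = size [seq (i, j) | i <- iota 1 r, j <- iota 1 s])%N.
    by rewrite size_allpairs !size_iota.
  rewrite cardE -(size_map (fun i => (a i, b i))).
  apply: uniq_leq_size; first by rewrite map_inj_uniq // enum_uniq.
  move=> q /mapP[i]; rewrite mem_enum inE => /andP[iX iY] ->.
  apply: allpairs_f; rewrite mem_iota add1n ltnS leq_divRL // mulnC.
    by rewrite a0.
  by rewrite b0.
have h1 := leq_trunc_div (4 * X) k; have h2 := leq_trunc_div (4 * Y) k.
move: ((4 * X) %/ k)%N ((4 * Y) %/ k)%N h1 h2 Srs => r s h1 h2 Srs.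
have h3 := leq_mul h1 h2.
have : (k * k * k <= 2 * (r * s) * k * k)%N.
  by rewrite !leq_mul2r; apply/orP; right; apply/orP; right; lia.
rewrite !expnS expn0 muln1; nia.
Qed.

Lemma sum_absz_increments (z : nat -> int) (k : nat) :
  (forall i, (i < k)%N -> z i <= z i.+1) ->
  (\sum_(i < k) `|z i.+1 - z i|%N)%:Z = z k - z 0%N.
Proof.
elim: k => [|k IH] mono; first by rewrite big_ord0 subrr.
rewrite big_ord_recr /= PoszD IH => [|i ik]; last exact/mono/ltnW.
by rewrite gez0_abs ?subr_ge0 ?mono//; ring.
Qed.

(* The functionals attached to the two inner points separate the slopes of
   the increments. *)
Lemma convex_chain_increment (R : realFieldType)
    (a1 b1 a2 b2 x0 x1 x2 x3 y0 y1 y2 y3 : R) :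
  0 <= a1 -> 0 <= b1 -> 0 <= a2 -> 0 <= b2 ->
  x0 < x1 -> x1 < x2 -> y1 < y0 -> y2 < y1 ->
  0 < a1 * (x0 - x1) + b1 * (y0 - y1) -> 0 < a2 * (x3 - x2) + b2 * (y3 - y2) ->
  0 < a1 * (x2 - x1) + b1 * (y2 - y1) -> 0 < a2 * (x1 - x2) + b2 * (y1 - y2) ->
  x1 - x0 = x3 - x2 -> y0 - y1 = y2 - y3 -> False.
Proof.
move=> a10 b10 a20 b20 lt01 lt12 gt01 gt12 h1 h2 h3 h4 ex ey.
have dx0 : 0 < x1 - x0 by lra.
have dy0 : 0 < y0 - y1 by lra.
have ex0 : 0 < x2 - x1 by lra.
have ey0 : 0 < y1 - y2 by lra.
have {}h1 : a1 * (x1 - x0) < b1 * (y0 - y1) by lra.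
have {}h2 : b2 * (y0 - y1) < a2 * (x1 - x0) by rewrite ex ey; lra.
have {}h3 : b1 * (y1 - y2) < a1 * (x2 - x1) by lra.
have {}h4 : a2 * (x2 - x1) < b2 * (y1 - y2) by lra.
move: (x1 - x0) (y0 - y1) (x2 - x1) (y1 - y2) dx0 dy0 ex0 ey0 h1 h2 h3 h4 =>
  dx dy px py dx0 dy0 px0 py0 h1 h2 h3 h4.
have b1p : 0 < b1 by nra.
have b2p : 0 < b2 by nra.
(* In terms of slopes, [py / px < a1 / b1 < dy / dx]; the second functional gives
   [dy / dx < a2 / b2 < py / px]. *)
have g1 : py * dx < px * dy.
  rewrite -(ltr_pM2l b1p).
  have : b1 * py * dx < a1 * px * dx by rewrite ltr_pM2r.
  have : a1 * dx * px < b1 * dy * px by rewrite ltr_pM2r.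
  by lra.
have g2 : px * dy < py * dx.
  rewrite -(ltr_pM2l b2p).
  have : b2 * dy * px < a2 * dx * px by rewrite ltr_pM2r.
  have : a2 * px * dx < b2 * py * dx by rewrite ltr_pM2r.
  by lra.
by lra.
Qed.

(** Each point of [A] strictly minimises a functional with nonnegative coefficients. Sorted by
    abscissa, these points therefore descend strictly along a convex chain, whose [#|A|.-1]
    increments are pairwise distinct. *)
Lemma convex_chain_bound (R : realFieldType) (I : finType) (A : {set I})
    (x y : I -> int) (alpha beta : I -> R) (X Y : nat) :
  {in A, forall i, 0 <= alpha i} -> {in A, forall i, 0 <= beta i} ->
  {in A &, forall i j, i != j ->
    0 < alpha i * (x j - x i)%:~R + beta i * (y j - y i)%:~R} ->
  (forall i j, `|x i - x j| <= X)%N -> (forall i j, `|y i - y j| <= Y)%N ->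
  (#|A|.-1 ^ 3 <= 32 * (X * Y))%N.
Proof.
have pos (b z : R) : 0 <= b -> 0 < b * z -> 0 < z.
  by move=> b0 bz; rewrite ltNge; apply/negP => z0; nra.
have pos2 (a b w z : R) : 0 <= a -> 0 <= b -> w < 0 -> 0 < a * w + b * z -> 0 < z.
  by move=> a0 b0 w0 h; apply: (pos b) => //; nra.
(* Two equal consecutive increments make the middle point the midpoint of its neighbours, so its
   functional takes opposite values on the two differences. *)
have adjacent (a b x0 x1 x2 y0 y1 y2 : R) :
    0 < a * (x0 - x1) + b * (y0 - y1) -> 0 < a * (x2 - x1) + b * (y2 - y1) ->
    x1 - x0 = x2 - x1 -> y0 - y1 = y1 - y2 -> False.
  move=> h1 h2 ex ey.
  have ex2 : x2 = x1 + (x1 - x0) by lra.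
  have ey2 : y2 = y1 + (y1 - y0) by lra.
  by rewrite ex2 ey2 in h2; lra.
move=> alpha0 beta0 extr xX yY.
have [->|[i0 i0A]] := set_0Vmem A; first by rewrite cards0.
pose s := sort (fun i j => x i <= x j) (enum A).
have size_s : size s = #|A| by rewrite size_sort cardE.
have uniq_s : uniq s by rewrite sort_uniq enum_uniq.
pose u := nth i0 s.
have uA i : (i < #|A|)%N -> u i \in A.
  by rewrite -size_s => /(mem_nth i0); rewrite mem_sort mem_enum.
have u_neq i j : (i < j < #|A|)%N -> u i != u j.
  by move=> /andP[ij jA]; rewrite nth_uniq ?size_s //; lia.
have u_le i j : (i < j < #|A|)%N -> x (u i) <= x (u j).
  move=> /andP[ij jA].
  have srt : sorted (fun i j => x i <= x j) s.
    by apply: sort_sorted => p q; exact: le_total.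
  apply: (sorted_ltn_nth _ i0 srt) => //; rewrite ?inE ?size_s //.
    by move=> p q r; exact: le_trans.
  exact: ltn_trans jA.
have u_lt i j : (i < j < #|A|)%N -> x (u i) < x (u j).
  (* With equal abscissas, each of the two points would have to lie strictly below the other. *)
  move=> ij; rewrite lt_neqAle u_le // andbT; apply/eqP => E.
  have /andP[ij' jA] := ij; have iA := ltn_trans ij' jA.
  have := extr _ _ (uA i iA) (uA j jA) (u_neq i j ij).
  have := extr _ _ (uA j jA) (uA i iA); rewrite eq_sym u_neq // => /(_ isT).
  rewrite E subrr !mulr0 !add0r !intrB => hj hi.
  have := pos _ _ (beta0 _ (uA i iA)) hi; have := pos _ _ (beta0 _ (uA j jA)) hj.
  by rewrite !subr_gt0 => /lt_trans h /h; rewrite ltxx.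
have u_gt i j : (i < j < #|A|)%N -> y (u j) < y (u i).
  move=> ij; rewrite -(ltr_int R).
  have := u_lt i j ij; rewrite -(ltr_int R) => xij.
  have /andP[ij' jA] := ij; have iA := ltn_trans ij' jA.
  have := extr _ _ (uA j jA) (uA i iA); rewrite eq_sym u_neq // => /(_ isT).
  rewrite !intrB => hj.
  rewrite -subr_gt0; apply: pos2 hj; rewrite ?subr_lt0 //.
    exact: alpha0 (uA j jA).
  exact: beta0 (uA j jA).
case E : #|A| => [|k] //=.
rewrite E in uA u_neq u_le u_lt u_gt.
have sumx := @sum_absz_increments (x \o u) k.
(* The ordinates decrease along the chain, hence the change of sign. *)
have sumy := @sum_absz_increments (fun i => - y (u i)) k.
pose dx (i : 'I_k) := `|x (u i.+1) - x (u i)|%N.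
pose dy (i : 'I_k) := `|(- y (u i.+1)) - (- y (u i))|%N.
have dxE (i : 'I_k) : (dx i)%:Z = x (u i.+1) - x (u i).
  by rewrite /dx gez0_abs // subr_ge0 ltW // u_lt //; have := ltn_ord i; lia.
have dyE (i : 'I_k) : (dy i)%:Z = y (u i) - y (u i.+1).
  rewrite /dy opprK addrC gez0_abs // subr_ge0 ltW // u_gt //.
  by have := ltn_ord i; lia.
have dx0 (i : 'I_k) : 0 < (dx i)%:Z.
  by rewrite dxE subr_gt0 u_lt //; have := ltn_ord i; lia.
have dy0 (i : 'I_k) : 0 < (dy i)%:Z.
  by rewrite dyE subr_gt0 u_gt //; have := ltn_ord i; lia.
apply: (@distinct_pairs_bound k dx dy X Y) => //.
- rewrite -lez_nat sumx /=; last by move=> i ik; rewrite u_le //; lia.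
  by have := xX (u k) (u 0%N); lia.
- rewrite -lez_nat sumy /=; last by move=> i ik; rewrite lerN2 ltW // u_gt //; lia.
  by have := yY (u k) (u 0%N); lia.
suff lt_neq (i j : 'I_k) : (i < j)%N -> (dx i, dy i) <> (dx j, dy j).
  move=> i j Eij; apply/val_inj; case: (ltngtP i j) => // /lt_neq; first by case.
  by move=> h; case: h; exact: esym.
move=> ij [Ex Ey].
have jk := ltn_ord j.
have := congr1 Posz Ex; have := congr1 Posz Ey; rewrite !dxE !dyE => dyij dxij.
have ik : (i < k)%N := ltn_trans ij jk.
have iA : (i < k.+1)%N by lia.
have i1A : (i.+1 < k.+1)%N by lia.
have jA : (j < k.+1)%N by lia.
have j1A : (j.+1 < k.+1)%N by lia.
have toR (z1 z2 z3 z4 : int) : z1 - z2 = z3 - z4 ->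
    (z1%:~R : R) - z2%:~R = z3%:~R - z4%:~R by rewrite -!intrB => ->.
have {dyij}dyij := toR _ _ _ _ dyij; have {dxij}dxij := toR _ _ _ _ dxij.
have := extr _ _ (uA _ i1A) (uA _ iA); rewrite eq_sym u_neq ?ltnSn // => /(_ isT) f1.
have := extr _ _ (uA _ jA) (uA _ j1A); rewrite u_neq ?ltnSn // => /(_ isT) f2.
have xlt := u_lt i i.+1; rewrite ltnSn /= -(ltr_int R) in xlt.
have {}xlt := xlt i1A.
have ylt := u_gt i i.+1; rewrite ltnSn /= -(ltr_int R) in ylt.
have {}ylt := ylt i1A.
have [a1 a2] := (alpha0 _ (uA _ i1A), alpha0 _ (uA _ jA)).
have [b1 b2] := (beta0 _ (uA _ i1A), beta0 _ (uA _ jA)).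
rewrite !intrB in f1 f2.
(* If [j = i.+1] the two increments share a point and [adjacent] applies; otherwise four distinct
   points are involved. *)
move: ij; rewrite leq_eqVlt => /orP[/eqP E1|ij].
  by rewrite -E1 in f2 dxij dyij; exact: adjacent f1 f2 dxij dyij.
have := extr _ _ (uA _ i1A) (uA _ jA); rewrite u_neq ?ij // => /(_ isT) f3.
have := extr _ _ (uA _ jA) (uA _ i1A); rewrite eq_sym u_neq ?ij // => /(_ isT) f4.
have := u_lt i.+1 j; rewrite ij /= -(ltr_int R) => /(_ jA) xlt2.
have := u_gt i.+1 j; rewrite ij /= -(ltr_int R) => /(_ jA) ylt2.
rewrite !intrB in f3 f4.
exact: convex_chain_increment a1 b1 a2 b2 xlt xlt2 ylt ylt2 f1 f2 f3 f4 dxij dyij.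
Qed.

(** The signs of the two coefficients split the points into four classes, one of which has more than
    [k] elements. Reflections in the axes make the functionals of that class nonnegative and
    preserve distances between coordinates. *)
Lemma convex_position_bound (R : realFieldType) (I : finType)
    (x y : I -> int) (alpha beta : I -> R) (X Y k : nat) :
  (forall i j, i != j ->
    0 < alpha i * (x j - x i)%:~R + beta i * (y j - y i)%:~R) ->
  (forall i j, `|x i - x j| <= X)%N -> (forall i j, `|y i - y j| <= Y)%N ->
  (4 * k < #|I|)%N -> (k ^ 3 <= 32 * (X * Y))%N.
Proof.
move=> extr xX yY kI.
pose c i := (alpha i < 0, beta i < 0).
have [[s t] kst] : exists st, (k < #|[set i | c i == st]|)%N.
  apply/existsP; apply: contraLR kI; rewrite negb_exists -leqNgt => /forallP small.
  rewrite -sum1_card (partition_big c predT) //=.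
  apply: (@leq_trans (\sum_(st : bool * bool) k)%N).
    apply: leq_sum => st _; have := small st; rewrite -leqNgt; apply: leq_trans.
    by rewrite -sum1_card; apply: eq_leq; apply: eq_bigl => i; rewrite inE.
  by rewrite sum_nat_const card_prod card_bool.
set A := [set i | _] in kst.
have sgn (z : R) : 0 <= (-1) ^+ (z < 0)%R * z.
  by case: (ltP z 0) => h; rewrite ?expr1 ?mulN1r ?oppr_ge0 ?expr0 ?mul1r // ltW.
have sgn2 (b : bool) (z w : R) : (-1) ^+ b * z * ((-1) ^+ b * w) = z * w.
  by case: b; rewrite ?expr1 ?expr0; ring.
have := @convex_chain_bound R I A (fun i => (-1) ^+ s * x i) (fun i => (-1) ^+ t * y i)
  (fun i => (-1) ^+ s * alpha i) (fun i => (-1) ^+ t * beta i) X Y.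
move=> bound; apply: (@leq_trans (#|A|.-1 ^ 3)); first by rewrite leq_exp2r //; lia.
apply: bound.
- by move=> i; rewrite inE => /eqP[<- _].
- by move=> i; rewrite inE => /eqP[_ <-].
- move=> i j _ _ ij; rewrite -!mulrBr !intrM !rmorph_sign !sgn2; exact: extr.
- by move=> i j; rewrite -mulrBr abszMsign.
- by move=> i j; rewrite -mulrBr abszMsign.
Qed.

(** * Outerplanar drawings on a parabola *)

Lemma parabola_segment (R : realType) (a b : R) (q : R * R) : a <= b ->
  segment (a, a ^+ 2) (b, b ^+ 2) q ->
  [/\ a <= q.1, q.1 <= b & q.2 = q.1 ^+ 2 + (q.1 - a) * (b - q.1)].
Proof. by move=> ab [t [t0 t1 ->]] /=; split; [nra|nra|ring]. Qed.

(* [(t - a) * (b - t)] is the height over the parabola of the chord from [a] to [b]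
   at the abscissa [t]. *)
Lemma parabola_chords_meet (R : realType) (a b c d t : R) :
  a < b -> c < d -> a <= t -> t <= b -> c <= t -> t <= d ->
  (t - a) * (b - t) = (t - c) * (d - t) -> ~ (a = c /\ b = d) ->
  [\/ b <= c, d <= a, c <= a /\ b <= d | a <= c /\ d <= b] ->
  (t = a \/ t = b) /\ (t = c \/ t = d).
Proof.
have nested (a' b' c' d' : R) : a' < b' -> a' <= t -> t <= b' ->
    (t - a') * (b' - t) = (t - c') * (d' - t) -> ~ (a' = c' /\ b' = d') ->
    c' <= a' -> b' <= d' -> (t = a' \/ t = b') /\ (t = c' \/ t = d').
  move=> ab at_ tb E ne ca bd.
  (* The difference of the two heights in [E] is the sum of these two nonnegative products, so both
     vanish. *)
  have h1 : 0 <= (a' - c') * (d' - t) by apply: mulr_ge0; lra.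
  have h2 : 0 <= (t - a') * (d' - b') by apply: mulr_ge0; lra.
  have /eqP : (a' - c') * (d' - t) = 0 by lra.
  have /eqP : (t - a') * (d' - b') = 0 by lra.
  rewrite !mulf_eq0 !subr_eq0 => /orP[/eqP e1|/eqP e1] /orP[/eqP e2|/eqP e2].
  - by split; left; rewrite // e1.
  - by split; [left|right].
  - by case: ne.
  - by split; right; lra.
move=> ab cd at_ tb ct td E ne [bc|da|[ca bd]|[ac db]].
- by split; [right|left]; lra.
- by split; [left|right]; lra.
- exact: nested.
- have ne' : ~ (c = a /\ d = b) by move=> [? ?]; apply: ne.
  by have [h1 h2] := nested c d a b cd ct td (esym E) ne' ac db; split.
Qed.

Definition parabola_drawing (R : realType) (n : nat) (i : 'I_n) : R * R :=
  (i%:R, i%:R ^+ 2).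

Lemma parabola_drawing_inj (R : realType) (n : nat) :
  injective (@parabola_drawing R n).
Proof. by move=> i j [/eqP]; rewrite eqr_nat => /eqP ij _; exact: val_inj. Qed.

Lemma parabola_drawing_segment (R : realType) (n : nat) (u v : 'I_n) (q : R * R) :
  (u <= v)%N -> segment (parabola_drawing R n u) (parabola_drawing R n v) q ->
  [/\ u%:R <= q.1, q.1 <= v%:R & q.2 = q.1 ^+ 2 + (q.1 - u%:R) * (v%:R - q.1)].
Proof. by move=> uv; apply: parabola_segment; rewrite ler_nat. Qed.

Lemma parabola_drawing_above (R : realType) (n : nat) (e : rel 'I_n) (q : R * R) :
  drawing_set e (parabola_drawing R n) q -> q.1 ^+ 2 <= q.2.
Proof.
move=> [[v ->]//|[u [v [_ uvq]]]].
have [uv|/ltnW vu] := leqP u v.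
  have [h1 h2 ->] := parabola_drawing_segment _ _ _ _ _ uv uvq.
  by rewrite lerDl mulr_ge0 ?subr_ge0.
have [h1 h2 ->] := parabola_drawing_segment _ _ _ _ _ vu (segment_sym _ _ _ _ uvq).
by rewrite lerDl mulr_ge0 ?subr_ge0.
Qed.

(** This is a one-page book embedding with the vertices in their natural order on the spine. *)
Definition noncrossing {n : nat} (e : rel 'I_n) : Prop :=
  forall u v w x : 'I_n, e u v -> e w x -> (u < v)%N -> (w < x)%N ->
    [|| v <= w, x <= u, (w <= u) && (v <= x) | (u <= w) && (x <= v)]%N.

(** A common point of two chords has the same abscissa and the same height over the parabola on
    both, so for noncrossing chords it is an endpoint of each. *)
Lemma parabola_planar (R : realType) (n : nat) (e : rel 'I_n) :
  symmetric e -> irreflexive e -> noncrossing e ->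
  planar_straight_line e (parabola_drawing R n).
Proof.
move=> esym eirr nc; split; first exact: parabola_drawing_inj.
(* Properties symmetric in the endpoints need only be checked on edges with increasing endpoints. *)
have orient (P : 'I_n -> 'I_n -> Prop) : (forall u v, P u v -> P v u) ->
    (forall u v : 'I_n, (u < v)%N -> e u v -> P u v) -> forall u v, e u v -> P u v.
  move=> symP h u v euv; case: (ltngtP u v) => uv; first exact: h.
    by apply: symP; apply: h => //; rewrite esym.
  by move: euv; rewrite (val_inj uv) eirr.
split=> [u v z euv|u v w x euv ewx].
  move: u v euv; apply: (orient (fun u v => z != u -> z != v -> ~ segment _ _ _)).
    by move=> u v h zv zu /segment_sym; exact: h.
  move=> u v uv _ zu zv /(parabola_drawing_segment _ _ _ _ _ (ltnW uv))[_ _ /= /eqP].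
  rewrite -subr_eq0 opprD addrA subrr sub0r oppr_eq0 mulf_eq0 !subr_eq0 !eqr_nat.
  by rewrite [_ == nat_of_ord z]eq_sym; case/orP => /eqP/val_inj E; rewrite E eqxx in zu zv.
move: u v euv; apply: (orient (fun u v => ~~ ((u == w) && (v == x) || (u == x) && (v == w)) ->
  forall q, segment (parabola_drawing R n u) (parabola_drawing R n v) q -> _ ->
  exists z, [/\ (z == u) || (z == v), _ & _])).
  move=> u v h; rewrite orbC ![(v == _) && _]andbC => /h{}h q /segment_sym s1 s2.
  by have [z [zuv zwx ->]] := h q s1 s2; exists z; split=> //; rewrite orbC.
move=> u v uv euv; move: w x ewx.
apply: (orient (fun w x => ~~ ((u == w) && (v == x) || (u == x) && (v == w)) ->
  forall q, _ -> segment (parabola_drawing R n w) (parabola_drawing R n x) q ->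
  exists z, [/\ _, (z == w) || (z == x) & _])).
  move=> w x h; rewrite orbC => /h{}h q s1 /segment_sym s2.
  by have [z [zuv zwx ->]] := h q s1 s2; exists z; split=> //; rewrite orbC.
move=> w x wx ewx /norP[ne _] q.
move=> /(parabola_drawing_segment _ _ _ _ _ (ltnW uv))[h1 h2 h3].
move=> /(parabola_drawing_segment _ _ _ _ _ (ltnW wx))[h4 h5 h6].
have [] := @parabola_chords_meet R u%:R v%:R w%:R x%:R q.1; rewrite ?ltr_nat //.
- by move: h6; rewrite h3 => /addrI.
- move=> [/eqP + /eqP]; rewrite !eqr_nat => /eqP/val_inj E1 /eqP/val_inj E2.
  by rewrite E1 E2 !eqxx in ne.
- rewrite !ler_nat.
  by case/or4P: (nc _ _ _ _ euv ewx uv wx) => [?|?|/andP[? ?]|/andP[? ?]];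
    [apply: Or41|apply: Or42|apply: Or43|apply: Or44].
have vertex (z : 'I_n) : q.1 = z%:R -> z = u \/ z = v -> q = parabola_drawing R n z.
  move=> qz zuv; apply: pair_ext => //; rewrite h3 qz.
  by case: zuv => ->; rewrite subrr ?mulr0 ?mul0r addr0.
have same (z z' : 'I_n) : q.1 = z%:R -> q.1 = z'%:R -> z = z'.
  by move=> -> /eqP; rewrite eqr_nat => /eqP/val_inj.
move=> [qu|qv] [qw|qx].
- exists u; rewrite eqxx (same _ _ qu qw) eqxx; split=> //.
  by apply: vertex; [rewrite -(same _ _ qu qw)|left; rewrite (same _ _ qu qw)].
- exists u; rewrite eqxx (same _ _ qu qx) eqxx orbT; split=> //.
  by apply: vertex; [rewrite -(same _ _ qu qx)|left; rewrite (same _ _ qu qx)].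
- exists v; rewrite eqxx (same _ _ qv qw) eqxx orbT; split=> //.
  by apply: vertex; [rewrite -(same _ _ qv qw)|right; rewrite (same _ _ qv qw)].
- exists v; rewrite eqxx (same _ _ qv qx) eqxx !orbT; split=> //.
  by apply: vertex; [rewrite -(same _ _ qv qx)|right; rewrite (same _ _ qv qx)].
Qed.

(* The open region below the parabola lies in the outer face, and every vertex is a
   limit of points of this region. *)
Lemma noncrossing_outerplanar (R : realType) (n : nat) (e : rel 'I_n) :
  symmetric e -> irreflexive e -> noncrossing e -> outerplanar R e.
Proof.
move=> esym eirr nc; exists (parabola_drawing R n).
split; first exact: parabola_planar.
set D := drawing_set e (parabola_drawing R n).
have below (q : R * R) : q.2 < q.1 ^+ 2 -> ~ D q.
  by move=> h /parabola_drawing_above; rewrite leNgt h.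
pose o : R * R := (0, -1).
have oD : ~ D o by apply: below; rewrite /o /= expr0n /=; lra.
set F := connected_component (~` D)%classic o.
(* The path goes horizontally from [o] to [(q.1, -1)], then vertically to [q], and stays below the
   parabola. *)
have inF q : q.2 < q.1 ^+ 2 -> F q.
  move=> qb.
  apply: (@connected_component_trans _ (~` D)%classic (q.1, -1)).
    apply: connected_component_segment => r [t [t0 t1 ->]].
    apply: below; have := sqr_ge0 ((1 - t) * o.1 + t * q.1); rewrite /= /o /=; lra.
  apply: connected_component_segment => r [t [t0 t1 ->]]; apply: below => /=.
  rewrite -mulrDl subrK mul1r.
  have h1 : 0 <= t * (q.1 ^+ 2 - q.2) by apply: mulr_ge0 => //; lra.
  have h2 : 0 <= (1 - t) * q.1 ^+ 2 by apply: mulr_ge0; [lra|exact: sqr_ge0].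
  move: t1; rewrite le_eqVlt => /orP[/eqP -> |t1]; lra.
move=> v; exists F; split; first split.
- by exists o.
- move=> [M bd].
  have /bd[_ /=] : F (0, - `|M| - 1).
    by apply: inF => /=; rewrite expr0n /=; have := normr_ge0 M; lra.
  by rewrite ler_norml => /andP[+ _]; have := ler_norm M; lra.
- move=> B /nbhs_ballP[eps /= eps0 sub].
  exists (v%:R, v%:R ^+ 2 - eps / 2); split; first by apply: inF => /=; lra.
  apply: sub; split => /=; first exact: ballxx.
  rewrite /ball /= opprB addrC subrK.
  by rewrite ger0_norm; lra.
Qed.

(** * The graph and its biconnectedness *)

(** The clauses are the edges of a Hamiltonian path, the sides of the polygon of even vertices, and
    its closing side, which for [m > 1] bears no ear. *)
Definition sun_arc (m a b : nat) : bool :=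
  [|| b == a.+1, ~~ odd a && (b == a.+2) | (a == 0%N) && (b == m.*2)].

(* The even vertices form an [m.+1]-gon; each odd vertex is joined to the endpoints of
   one of its sides. *)
Definition sun (m : nat) : rel 'I_m.*2.+1 :=
  fun u v => sun_arc m u v || sun_arc m v u.

Lemma sun_sym (m : nat) : symmetric (sun m).
Proof. by move=> u v; rewrite /sun /= orbC. Qed.

Lemma sun_irr (m : nat) : (0 < m)%N -> irreflexive (sun m).
Proof. by move=> m0 u; rewrite /sun /sun_arc /=; lia. Qed.

Lemma sun_noncrossing (m : nat) : noncrossing (sun m).
Proof.
move=> u v w x; rewrite /sun /sun_arc /= => euv ewx uv wx.
have := ltn_ord u; have := ltn_ord v; have := ltn_ord w; have := ltn_ord x.
lia.
Qed.

(** The walk visits the vertices from 0 to [x] in order; [P] serves to keep off a deleted vertex. *)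
Lemma sun_connect_low (m : nat) (P : pred 'I_m.*2.+1) (x : 'I_m.*2.+1) :
  (forall y : 'I_m.*2.+1, (y <= x)%N -> P y) ->
  connect [rel a b | [&& sun m a b, P a & P b]] ord0 x.
Proof.
case: x => k kn; elim: k kn => [|k IH] kn h.
  by rewrite (_ : Ordinal kn = ord0) ?connect0 //; exact: val_inj.
have kn' : (k < m.*2.+1)%N by exact: ltnW.
apply: (connect_trans (IH kn' _)); first by move=> y /= yk; apply: h => /=; lia.
apply: connect1; rewrite /= /sun /= /sun_arc /= eqxx /=.
by rewrite !h.
Qed.

Lemma sun_connect_high (m : nat) (P : pred 'I_m.*2.+1) (x : 'I_m.*2.+1) :
  (forall y : 'I_m.*2.+1, (x <= y)%N -> P y) ->
  connect [rel a b | [&& sun m a b, P a & P b]] x ord_max.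
Proof.
move: {2}(m.*2 - x)%N (erefl (m.*2 - x)%N) => d; elim: d x => [|d IH] x E h.
  rewrite (_ : x = ord_max) ?connect0 //; apply: val_inj => /=.
  by have := ltn_ord x; lia.
have xn : (x.+1 < m.*2.+1)%N by lia.
apply: (@connect_trans _ _ (Ordinal xn)); last first.
  by apply: IH => /= [|y xy]; [lia|apply: h; lia].
apply: connect1; rewrite /= /sun /= /sun_arc /= eqxx /=.
by rewrite !h.
Qed.

(** Consecutive vertices and the closing side form a Hamiltonian cycle. Deleting [v] leaves the
    vertices below and above it, joined through the edge between 0 and [m.*2]. *)
Lemma sun_biconnected (m : nat) : (0 < m)%N -> biconnected (sun m).
Proof.
move=> m0; split; first by lia.
  have all0 x : connect (sun m) ord0 x.
    apply: connect_sub (@sun_connect_low m predT x (fun _ _ => isT)) => a b /=.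
    by rewrite andbT; exact: connect1.
  move=> x y; apply: connect_trans (all0 y).
  by rewrite (sym_connect_sym (@sun_sym m)).
move=> v.
have asym : connect_sym (avoid_rel (sun m) v).
  apply: sym_connect_sym => a b; rewrite /avoid_rel /= sun_sym; congr (_ && _).
  exact: andbC.
have low (x : 'I_m.*2.+1) : (x < v)%N -> connect (avoid_rel (sun m) v) ord0 x.
  move=> xv; apply: (@sun_connect_low m [pred y | y != v] x) => y yx /=.
  by apply/eqP => E; rewrite E in yx; lia.
have high (x : 'I_m.*2.+1) : (v < x)%N -> connect (avoid_rel (sun m) v) x ord_max.
  move=> xv; apply: (@sun_connect_high m [pred y | y != v] x) => y yx /=.
  by apply/eqP => E; rewrite E in yx; lia.
suff [r h] : exists r, forall x, x != v -> connect (avoid_rel (sun m) v) x r.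
  move=> x y xv yv; apply: connect_trans (h x xv) _; rewrite asym; exact: h.
have split_ord (x : 'I_m.*2.+1) : x != v -> (x < v)%N || (v < x)%N by rewrite -neq_ltn.
(* When the last vertex is deleted, only the lower path remains and 0 serves as root. *)
have [vmax|vmax] := eqVneq v ord_max.
  exists ord0 => x /split_ord /orP[/low|]; first by rewrite asym.
  by rewrite vmax /=; have := ltn_ord x; lia.
exists ord_max => x /split_ord /orP[xv|/high //].
apply: (@connect_trans _ _ ord0); first by rewrite asym; exact: low.
apply: connect1; rewrite /avoid_rel /= /sun /sun_arc /= eqxx !orbT /= [ord_max == v]eq_sym vmax andbT.
by apply/eqP => E; rewrite -E in xv.
Qed.

(** * The area bound *)

Lemma leq_grid_width (n : nat) (g : 'I_n -> int * int) (i j : 'I_n) :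
  (`|(g i).1 - (g j).1| <= grid_width g)%N.
Proof.
apply: leqW; apply: leq_trans (leq_bigmax i).
exact: (@leq_bigmax _ (fun j => `|(g i).1 - (g j).1|%N) j).
Qed.

Lemma leq_grid_height (n : nat) (g : 'I_n -> int * int) (i j : 'I_n) :
  (`|(g i).2 - (g j).2| <= grid_height g)%N.
Proof.
apply: leqW; apply: leq_trans (leq_bigmax i).
exact: (@leq_bigmax _ (fun j => `|(g i).2 - (g j).2|%N) j).
Qed.

Lemma sun_ear_extreme (R : realType) (m : nat) (p : 'I_m.*2.+1 -> R * R)
    (v : 'I_m.*2.+1) :
  convex_drawing (sun m) p -> odd v ->
  exists a b : R, forall z, z != v ->
    0 < a * ((p z).1 - (p v).1) + b * ((p z).2 - (p v).2).
Proof.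
move=> cp vodd; have vn := ltn_ord v.
have m0 : (0 < m)%N by lia.
have un : (v.-1 < m.*2.+1)%N by lia.
have wn : (v.+1 < m.*2.+1)%N by lia.
apply: (@ear_extreme R _ (sun m) p v (Ordinal un) (Ordinal wn)) => //.
- exact: sun_sym.
- exact: sun_irr.
- by rewrite /sun /sun_arc /=; lia.
- by rewrite /sun /sun_arc /=; lia.
- by rewrite /sun /sun_arc /=; lia.
- move=> z; rewrite /sun /sun_arc /= => vz.
  have [zv|zv] := ltnP z v; [left|right]; apply: val_inj => /=; lia.
Qed.

Lemma sun_grid_area (R : realType) (m k : nat) (g : 'I_m.*2.+1 -> int * int) :
  (4 * k < m)%N -> convex_grid_drawing R (sun m) g -> (k ^ 3 <= 32 * grid_area g)%N.
Proof.
move=> km [_ cg].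
have ear_lt (i : 'I_m) : (i.*2.+1 < m.*2.+1)%N by have := ltn_ord i; lia.
pose ear i := Ordinal (ear_lt i).
have ear_inj : injective ear.
  by move=> i j /(congr1 val) /= [/double_inj/val_inj].
have /choice[ab abP] : forall i, exists ab : R * R, forall z, z != ear i ->
    0 < ab.1 * ((grid_to_pt R g z).1 - (grid_to_pt R g (ear i)).1)
      + ab.2 * ((grid_to_pt R g z).2 - (grid_to_pt R g (ear i)).2).
  move=> i; have [|a [b abP]] := @sun_ear_extreme R m _ (ear i) cg.
    by rewrite /= odd_double.
  by exists (a, b).
apply: (@convex_position_bound R 'I_m (fun i => (g (ear i)).1) (fun i => (g (ear i)).2)
  (fun i => (ab i).1) (fun i => (ab i).2)).
- move=> i j ij; rewrite !intrB; apply: (abP i (ear j)).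
  by rewrite (inj_eq ear_inj) eq_sym.
- by move=> i j; exact: leq_grid_width.
- by move=> i j; exact: leq_grid_height.
- by rewrite card_ord.
Qed.

Theorem theorem1 (R : realType) :
  exists c : R, 0 < c /\
    forall N : nat, exists n : nat, (N <= n)%N /\ (0 < n)%N /\
      exists e : rel 'I_n,
        [/\ simple_graph e, biconnected e, outerplanar R e &
          forall g : 'I_n -> int * int, convex_grid_drawing R e g ->
            c * (n%:R) ^+ 3 <= (grid_area g)%:R].
Proof.
(* With [m = 4 k + 1] ears the number of vertices is [8 k + 3], at most [11 k] since [k] is
   positive, while [k ^ 3] is at most 32 times the area. *)
exists (32 * 11 ^ 3)%:R^-1; split; first by rewrite invr_gt0 ltr0n.
move=> N; pose k := N.+1; pose m := (4 * k).+1.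
exists m.*2.+1; split; first by rewrite /m /k; lia.
split=> //; exists (sun m).
have irr : irreflexive (sun m) by exact: sun_irr.
split.
- by split; [exact: sun_sym|].
- exact: sun_biconnected.
- by apply: noncrossing_outerplanar => //; [exact: sun_sym|exact: sun_noncrossing].
move=> g cg; rewrite mulrC ler_pdivrMr ?ltr0n // -natrX -natrM ler_nat.
have le_n : (m.*2.+1 ^ 3 <= (11 * k) ^ 3)%N by rewrite leq_exp2r // /m /k; lia.
apply: leq_trans le_n _; rewrite expnMn mulnA [leqRHS]mulnC mulnC -mulnA mulnC.
have := @sun_grid_area R m k g (ltnSn _) cg; nia.
Qed.
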